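(* For any diagonal section $\delta$, $$\mu_\delta=\max_{x\in[0,1]}\ \min_{t\in[x,g^\delta_U(x)]}\widehat{\delta}(t).$$
   Context: $\mathbb{I}=[0,1]$. A (bivariate) copula is a function $C\colon\mathbb{I}^2\to\mathbb{I}$ with $C(x,0)=C(0,y)=0$, $C(x,1)=x$, $C(1,y)=y$, and $C(b,d)+C(a,c)-C(b,c)-C(a,d)\ge 0$ for all $a\le b$, $c\le d$. A diagonal section is $\delta\colon\mathbb{I}\to\mathbb{I}$ with $\delta(x)\le x$, $0\le\delta(y)-\delta(x)\le 2(y-x)$ for $x\le y$, $\delta(1)=1$; $\widehat{\delta}(x)=x-\delta(x)$. The asymmetry of a copula $C$ is $\mu(C)=\max_{x,y\in\mathbb{I}}|C(x,y)-C(y,x)|$, and $\mu_\delta=\sup\{\mu(C): C\text{ copula with } C(t,t)=\delta(t)\ \forall t\}$. For $x\le y$ let $\mathrm{TV}_x^y(\widehat{\delta})$ be the total variation of $\widehat{\delta}$ on $[x,y]$, and for $y<x$ set $\mathrm{TV}_x^y=-\mathrm{TV}_y^x$. Let $f^\delta(x,y)=y-\frac12(\widehat{\delta}(x)+\widehat{\delta}(y)+\mathrm{TV}_x^y(\widehat{\delta}))$, $D_f^\circ(\delta)=\{(x,y)\in\mathbb{I}^2: f^\delta(x,y)<\min\{x,y\}\}$, $D_f(\delta)=\overline{D_f^\circ(\delta)}\cup\{(x,x):x\in\mathbb{I}\}$, and $g^\delta_U(x)=\max\{y\in\mathbb{I}:(x,y)\in D_f(\delta)\}$. *)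

(* Defs.v *)
From HB Require Import structures.
From mathcomp Require Import all_boot all_order all_algebra.
From mathcomp Require Import all_classical all_reals all_analysis.
Set Implicit Arguments. Unset Strict Implicit. Unset Printing Implicit Defensive.
Import Order.TTheory GRing.Theory Num.Theory.
Import numFieldNormedType.Exports.
Local Open Scope classical_set_scope.
Local Open Scope ring_scope.

Section Defs.
Variable R : realType.

Definition is_copula (C : R -> R -> R) : Prop :=
  [/\ (forall x y, 0 <= x <= 1 -> 0 <= y <= 1 -> 0 <= C x y <= 1),
      (forall x, 0 <= x <= 1 -> C x 0 = 0 /\ C 0 x = 0),
      (forall x, 0 <= x <= 1 -> C x 1 = x /\ C 1 x = x) &
      (forall a b c d, 0 <= a -> a <= b -> b <= 1 -> 0 <= c -> c <= d -> d <= 1 ->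
         C b d + C a c - C b c - C a d >= 0)].

Definition is_diagonal (delta : R -> R) : Prop :=
  [/\ (forall x, 0 <= x <= 1 -> 0 <= delta x <= 1),
      (forall x, 0 <= x <= 1 -> delta x <= x),
      (forall x y, 0 <= x -> x <= y -> y <= 1 ->
         0 <= delta y - delta x <= 2 * (y - x)) &
      delta 1 = 1].

Definition dhat (delta : R -> R) (x : R) : R := x - delta x.

(* signed total variation TV_x^y of dhat (finite since dhat is Lipschitz) *)
Definition TVs (delta : R -> R) (x y : R) : R :=
  if x <= y then fine (total_variation x y (dhat delta))
  else - fine (total_variation y x (dhat delta)).

Definition f_delta (delta : R -> R) (x y : R) : R :=
  y - (dhat delta x + dhat delta y + TVs delta x y) / 2.

Definition Df_open (delta : R -> R) : set (R * R) :=
  [set p | (0 <= p.1 <= 1) /\ (0 <= p.2 <= 1) /\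
           f_delta delta p.1 p.2 < Num.min p.1 p.2].

Definition Df (delta : R -> R) : set (R * R) :=
  closure (Df_open delta) `|` [set p | (0 <= p.1 <= 1) /\ p.2 = p.1].

(* g_U(x) = max {y in [0,1] | (x,y) in D_f} (the set is closed, nonempty) *)
Definition gU (delta : R -> R) (x : R) : R :=
  sup [set y | (0 <= y <= 1) /\ Df delta (x, y)].

Definition asym (C : R -> R -> R) : R :=
  sup [set z | exists x y, [/\ 0 <= x <= 1, 0 <= y <= 1 & z = `|C x y - C y x|]].

Definition mu_delta (delta : R -> R) : R :=
  sup [set m | exists C, [/\ is_copula C,
                             (forall t, 0 <= t <= 1 -> C t t = delta t) &
                             m = asym C]].

Definition minF (delta : R -> R) (x : R) : R :=
  inf [set dhat delta t | t in [set t | x <= t <= gU delta x]].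

End Defs.

(* Main.v *)
Require Import Defs.
From HB Require Import structures.
From mathcomp Require Import all_boot all_order all_algebra.
From mathcomp Require Import all_classical all_reals all_analysis.
From mathcomp Require Import lra.
Import Order.TTheory GRing.Theory Num.Theory.
Import numFieldNormedType.Exports.
Local Open Scope ring_scope.
Local Open Scope classical_set_scope.

(* Let h = dhat delta and let N and P be its negative and positive variations on
   [0, x], so that f(x, y) = N(x) + (y - P(y)) is modular.  For x <= y, every copula C
   with diagonal delta satisfies C(x, y) <= min(x, f(x, y)) and
   C(y, x) >= x - min_[x, y] h, and one copula attains both bounds everywhere; hence
   mu_delta is the maximum over x <= y of min(x, f(x, y)) - x + min_[x, y] h.  At
   y = gU(x) this is min_[x, gU(x)] h because f(x, gU(x)) >= x.  Conversely, when
   f(x, y) < x, one replaces x by the u <= x with f(u, y) = u: then h only drops by at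
   most x - f(x, y) on [u, x], and h increases on [y, gU(u)], where y - P(y) is
   constant. *)

(** * Total variation and Lipschitz functions *)

Section Preliminaries.
Context {R : realType}.

(** The hypothesis makes (G + h)/2 and (G - h)/2 nondecreasing; [h] is their difference, and their
    increments add up to that of [G]. *)
Lemma total_variation_le_increment (a b : R) (h G : R -> R) : a <= b ->
  (forall u v, a <= u -> u <= v -> v <= b -> `|h v - h u| <= G v - G u) ->
  (total_variation a b h <= (G b - G a)%:E)%E.
Proof.
move=> ab hG.
pose p u := (G u + h u) / 2; pose q u := (G u - h u) / 2.
have pm : {in `[a, b]%R &, nondecreasing_fun p}.
  move=> u v; rewrite !in_itv /= => /andP[au _] /andP[_ vb] uv.
  by have := hG u v au uv vb; rewrite ler_norml /p; lra.
have qm : {in `[a, b]%R &, nondecreasing_fun q}.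
  move=> u v; rewrite !in_itv /= => /andP[au _] /andP[_ vb] uv.
  by have := hG u v au uv vb; rewrite ler_norml /q; lra.
have -> : h = (p \+ \- q)%R by apply/funext => u; rewrite /p /q /=; lra.
apply: le_trans (total_variation_le _ _ ab) _.
rewrite total_variationN (nondecreasing_total_variation ab pm).
rewrite (nondecreasing_total_variation ab qm) -EFinD lee_fin /p /q.
by lra.
Qed.

Lemma lipschitz_within_continuous (V : normedModType R) (A : set V) (f : V -> R)
    (k : R) :
  (forall u v, A u -> A v -> `|f u - f v| <= k * `|u - v|) ->
  {within A, continuous f}.
Proof.
move=> fk; apply/subspace_continuousP => u Au.
apply/cvgrPdist_le => /= e e0.
(* [k] may be nonpositive; [Num.max k 1] is a constant one can divide by. *)
have k0 : 0 < Num.max k 1 by rewrite lt_max ltr01 orbT.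
near=> v.
have Av : A v by near: v; apply: withinT; exact: nbhs_filter.
apply: le_trans (fk _ _ Au Av) _.
apply: (@le_trans _ _ (Num.max k 1 * `|u - v|)).
  by rewrite ler_wpM2r// le_max lexx.
rewrite mulrC -ler_pdivlMr//.
near: v; apply: cvg_within; apply: filterS (nbhsx_ballx u _ (divr_gt0 e0 k0)).
by move=> v; rewrite -ball_normE /= => /ltW.
Unshelve. all: by end_near. Qed.

End Preliminaries.

(** * General facts on copulas *)

Section Copula.
Context {R : realType}.
Implicit Types (C : R -> R -> R) (a b c d s t u v x y : R).

Lemma copula_transpose C : is_copula C -> is_copula (fun x y => C y x).
Proof.
case=> C01 C0 C1 CV; split.
- by move=> x y x01 y01; exact: C01.
- by move=> x /C0[].
- by move=> x /C1[].
- move=> a b c d a0 ab b1 c0 cd d1.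
  by have := CV c d a b c0 cd d1 a0 ab b1; lra.
Qed.

Lemma copula_increment C x u v : is_copula C ->
  0 <= x <= 1 -> 0 <= u -> u <= v -> v <= 1 -> 0 <= C x v - C x u <= v - u.
Proof.
case=> C01 C0 C1 CV /andP[x0 x1] u0 uv v1.
have := CV 0 x u v (lexx _) x0 x1 u0 uv v1.
have := CV x 1 u v x0 x1 (lexx _) u0 uv v1.
have [|? ?] := C0 u; first by lra.
have [|? ?] := C0 v; first by lra.
have [|? ?] := C1 u; first by lra.
have [|? ?] := C1 v; first by lra.
by lra.
Qed.

Lemma copula_dist C x u v : is_copula C ->
  0 <= x <= 1 -> 0 <= u <= 1 -> 0 <= v <= 1 -> `|C x u - C x v| <= `|u - v|.
Proof.
move=> cC x01 /andP[u0 u1] /andP[v0 v1].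
have [uv|/ltW vu] := leP u v.
  have := copula_increment C x u v cC x01 u0 uv v1.
  rewrite -(normrN (u - v)) opprB (ger0_norm (_ : 0 <= v - u)); last by lra.
  by rewrite ler_norml; lra.
have := copula_increment C x v u cC x01 v0 vu u1.
rewrite (ger0_norm (_ : 0 <= u - v)); last by lra.
by rewrite ler_norml; lra.
Qed.

(** Mass is additive, and a rectangle meeting the diagonal splits into a square centred on it and
    two rectangles, each on one side. This suits functions given by different formulas above and
    below the diagonal. *)
Lemma two_increasing_diag_split C :
  (forall s t, 0 <= s -> s <= t -> t <= 1 -> C s t + C t s <= C s s + C t t) ->
  (forall a b c d, 0 <= a -> a <= b -> b <= c -> c <= d -> d <= 1 ->
    C b c + C a d <= C b d + C a c) ->
  (forall a b c d, 0 <= a -> a <= b -> b <= c -> c <= d -> d <= 1 ->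
    C c b + C d a <= C d b + C c a) ->
  forall a b c d, 0 <= a -> a <= b -> b <= 1 -> 0 <= c -> c <= d -> d <= 1 ->
    C b d + C a c - C b c - C a d >= 0.
Proof.
move=> Csq Cup Clo a b c d a0 ab b1 c0 cd d1.
have [bc|/ltW cb] := leP b c; first by have := Cup a b c d a0 ab bc cd d1; lra.
have [da|/ltW ad] := leP d a; first by have := Clo c d a b c0 cd da ab b1; lra.
have [ac|/ltW ca] := leP a c; have [bd|/ltW db] := leP b d.
- have := Cup a c c d a0 ac (lexx _) cd d1.
  have := Csq c b c0 cb b1.
  by have := Cup c b b d c0 cb (lexx _) bd d1; lra.
- have := Cup a c c d a0 ac (lexx _) cd d1.
  have := Csq c d c0 cd d1.
  by have := Clo c d d b c0 cd (lexx _) db b1; lra.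
- have := Clo c a a b c0 ca (lexx _) ab b1.
  have := Csq a b a0 ab b1.
  by have := Cup a b b d a0 ab (lexx _) bd d1; lra.
- have := Clo c a a b c0 ca (lexx _) ab b1.
  have := Csq a d a0 ad d1.
  by have := Clo a d d b a0 ad (lexx _) db b1; lra.
Qed.

End Copula.

(** * Variation of [h] and the modular form of f *)

Section Diagonal.
Context {R : realType} (delta : R -> R).
Implicit Types x y z t u v c d : R.
Hypothesis delta_diag : is_diagonal delta.

Local Notation h := (dhat delta).

Definition variation_from0 (x : R) : R := fine (total_variation 0 x h).
Local Notation T := variation_from0.

Lemma dhat_increment x y : 0 <= x -> x <= y -> y <= 1 -> `|h y - h x| <= y - x.
Proof.
case: delta_diag => _ _ dL _ x0 xy y1.
by have := dL x y x0 xy y1; rewrite ler_norml /dhat; lra.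
Qed.

Lemma dhat_ge0 x : 0 <= x <= 1 -> 0 <= h x.
Proof. by case: delta_diag => _ dx _ _ /dx; rewrite /dhat; lra. Qed.

Lemma dhat_le x : 0 <= x <= 1 -> h x <= x.
Proof. by case: delta_diag => d0 _ _ _ /d0; rewrite /dhat; lra. Qed.

Lemma dhat0 : h 0 = 0.
Proof.
have := dhat_ge0 0; have := dhat_le 0; rewrite lexx ler01 => /(_ isT) + /(_ isT).
by lra.
Qed.

Lemma dhat1 : h 1 = 0.
Proof. by case: delta_diag => _ _ _ d1; rewrite /dhat d1 subrr. Qed.

Lemma total_variation_dhat x y : 0 <= x -> x <= y -> y <= 1 ->
  (total_variation x y h <= (y - x)%:E)%E.
Proof.
move=> x0 xy y1; apply: (total_variation_le_increment x y h id xy) => u v xu uv vy.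
by apply: dhat_increment => //; lra.
Qed.

Lemma total_variation_dhat_fin x y : 0 <= x -> x <= y -> y <= 1 ->
  total_variation x y h \is a fin_num.
Proof.
move=> x0 xy y1; rewrite ge0_fin_numE ?total_variation_ge0//.
exact: le_lt_trans (total_variation_dhat x y x0 xy y1) (ltry _).
Qed.

Lemma variation_from0B x y : 0 <= x -> x <= y -> y <= 1 ->
  T y - T x = fine (total_variation x y h).
Proof.
move=> x0 xy y1; rewrite /T (total_variationD _ x0 xy) fineD.
- by rewrite addrC addKr.
- by apply: total_variation_dhat_fin => //; exact: le_trans xy y1.
- exact: total_variation_dhat_fin.
Qed.

Lemma variation_from0_increment x y : 0 <= x -> x <= y -> y <= 1 ->
  `|h y - h x| <= T y - T x <= y - x.
Proof.
move=> x0 xy y1; rewrite variation_from0B//.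
rewrite -!lee_fin fineK ?total_variation_dhat_fin// total_variation_ge//=.
exact: total_variation_dhat.
Qed.

Lemma variation_from0_bounds x y : 0 <= x -> x <= y -> y <= 1 ->
  [/\ h y - h x <= T y - T x, h x - h y <= T y - T x & T y - T x <= y - x].
Proof.
move=> x0 xy y1; have := variation_from0_increment x y x0 xy y1.
by rewrite ler_norml => /andP[/andP[? ?] ?]; split; lra.
Qed.

Lemma variation_from00 : T 0 = 0.
Proof. by rewrite /T total_variationxx. Qed.

Lemma TVsE x y : 0 <= x <= 1 -> 0 <= y <= 1 -> TVs delta x y = T y - T x.
Proof.
move=> /andP[x0 x1] /andP[y0 y1]; rewrite /TVs; case: ifPn => [xy|].
  by rewrite variation_from0B.
by rewrite -ltNge => /ltW yx; rewrite -variation_from0B// opprB.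
Qed.

(** As h(0) = 0, these are N(x) and y - P(y), with h = P - N and T = P + N. *)
Definition negvar (x : R) : R := (T x - h x) / 2.
Definition posvar_defect (y : R) : R := y - (T y + h y) / 2.
Local Notation a := negvar.
Local Notation b := posvar_defect.

Lemma f_deltaE x y : 0 <= x <= 1 -> 0 <= y <= 1 -> f_delta delta x y = a x + b y.
Proof. by move=> x01 y01; rewrite /f_delta TVsE// /a /b; lra. Qed.

Lemma negvar_increment x y : 0 <= x -> x <= y -> y <= 1 -> 0 <= a y - a x <= y - x.
Proof. by move=> x0 xy y1; case: (variation_from0_bounds x y x0 xy y1); rewrite /a; lra. Qed.

Lemma posvar_increment x y : 0 <= x -> x <= y -> y <= 1 -> 0 <= b y - b x <= y - x.
Proof. by move=> x0 xy y1; case: (variation_from0_bounds x y x0 xy y1); rewrite /b; lra. Qed.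

Lemma negvar_posvar_diag x : a x + b x = delta x.
Proof. by rewrite /a /b /dhat; lra. Qed.

Lemma negvar0 : a 0 = 0. Proof. by rewrite /a variation_from00 dhat0; lra. Qed.

Lemma posvar0 : b 0 = 0. Proof. by rewrite /b variation_from00 dhat0; lra. Qed.

(** At x = 1 the right side is delta(1) = 1, and [a] is 1-Lipschitz. *)
Lemma le_f1 x : 0 <= x <= 1 -> x <= a x + b 1.
Proof.
move=> /andP[x0 x1]; have := negvar_increment x 1 x0 x1 (lexx _).
have := negvar_posvar_diag 1; case: delta_diag => _ _ _ ->; lra.
Qed.

(** Since h + a = P, this says that P grows by at most y - x. *)
Lemma dhat_drop x y : 0 <= x -> x <= y -> y <= 1 ->
  h y - h x <= (y - a y) - (x - a x).
Proof. by move=> x0 xy y1; case: (variation_from0_bounds x y x0 xy y1); rewrite /a; lra. Qed.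

(** If [b] is constant, P alone uses up the whole variation allowance y - x, so N cannot grow. *)
Lemma posvar_flat x y : 0 <= x -> x <= y -> y <= 1 -> b y = b x -> h x <= h y.
Proof. by move=> x0 xy y1; case: (variation_from0_bounds x y x0 xy y1); rewrite /b; lra. Qed.

(** * Interval minima of [h] and bounds on copulas with diagonal [delta] *)

Definition dhat_min (x y : R) : R := inf [set h t | t in [set t | x <= t <= y]].
Local Notation m := dhat_min.

Lemma dhat_min_le x y t : 0 <= x -> y <= 1 -> x <= t <= y -> m x y <= h t.
Proof.
move=> x0 y1 xty; apply: ge_inf; last by exists t.
by exists 0 => _ [s /= /andP[xs sy] <-]; apply: dhat_ge0; lra.
Qed.

Lemma dhat_min_ge x y z : x <= y -> (forall t, x <= t <= y -> z <= h t) ->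
  z <= m x y.
Proof.
move=> xy zh; apply: lb_le_inf; first by exists (h x), x => //=; rewrite lexx.
by move=> _ [s /= xsy <-]; exact: zh.
Qed.

Lemma dhat_min_ge0 x y : 0 <= x -> x <= y -> y <= 1 -> 0 <= m x y.
Proof.
by move=> x0 xy y1; apply: dhat_min_ge => // t /andP[? ?]; apply: dhat_ge0; lra.
Qed.

(* Writing [Delta] for increments over [u, v], the mass of [0, x] x [u, v] is at
   most both [Delta delta] and [v - u], i.e. at most [v - u - max 0 (Delta h)]. *)
Lemma copula_le_modular C x y : is_copula C ->
  (forall t, 0 <= t <= 1 -> C t t = delta t) ->
  0 <= x -> x <= y -> y <= 1 -> C x y <= a x + b y.
Proof.
move=> cC Cd x0 xy y1.
(* Chosen so that both signs of |Delta h| <= Delta G are exactly the two bounds on the mass. *)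
pose G v := 2 * v - h v - 2 * C x v.
have : T y - T x <= G y - G x.
  rewrite variation_from0B// -lee_fin fineK ?total_variation_dhat_fin//.
  apply: (total_variation_le_increment x y h G xy) => u v xu uv vy.
  have [u01 v01] : 0 <= u <= 1 /\ 0 <= v <= 1 by split; lra.
  have [x01 u0 v1] : [/\ 0 <= x <= 1, 0 <= u & v <= 1] by split; lra.
  case: (cC) => _ _ _ /(_ x u u v x0 xu (andP u01).2 u0 uv v1).
  have := copula_increment _ v u v (copula_transpose _ cC) v01 u0 uv v1.
  have := copula_increment C x u v cC x01 u0 uv v1.
  by rewrite ler_norml /G /dhat /= !Cd//; lra.
rewrite /G Cd; last by lra.
by rewrite /a /b /dhat; lra.
Qed.

(** For every t in [x, y], C(y, x) >= C(t, x) >= C(t, t) - (t - x) = x - h(t). *)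
Lemma copula_ge_dhat_min C x y : is_copula C ->
  (forall t, 0 <= t <= 1 -> C t t = delta t) ->
  0 <= x -> x <= y -> y <= 1 -> x - m x y <= C y x.
Proof.
move=> cC Cd x0 xy y1.
suff : x - C y x <= m x y by lra.
apply: dhat_min_ge => // t /andP[xt ty].
have [t01 x01] : 0 <= t <= 1 /\ 0 <= x <= 1 by split; lra.
have t0 : 0 <= t by lra.
have := copula_increment _ x t y (copula_transpose _ cC) x01 t0 ty y1.
have := copula_increment C t x t cC t01 x0 xt (andP t01).2.
by rewrite /dhat Cd//; lra.
Qed.

(** Average the lower bounds on h(t) obtained by starting from h(x) and from h(y). This will give
    nonnegative mass to squares centred on the diagonal. *)
Lemma dhat_min_ge_average x y : 0 <= x -> x <= y -> y <= 1 ->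
  x - m x y <= a y + b x.
Proof.
move=> x0 xy y1; suff : x - (a y + b x) <= m x y by lra.
apply: dhat_min_ge => // t /andP[xt ty].
case: (variation_from0_bounds x t x0 xt (le_trans ty y1)) => _ + _.
case: (variation_from0_bounds t y (le_trans x0 xt) ty y1) => + _ _.
by rewrite /a /b; lra.
Qed.

(** * The extremal copula *)

(* The largest admissible value above the diagonal, the smallest one (that of the
   Bertino copula) below it. *)
Definition extremal_copula (x y : R) : R :=
  if x <= y then Num.min x (a x + b y) else y - m y x.
Local Notation K := extremal_copula.

Lemma extremal_above x y : x <= y -> K x y = Num.min x (a x + b y).
Proof. by rewrite /K => ->. Qed.

Lemma extremal_diag t : 0 <= t <= 1 -> K t t = delta t.
Proof.
case: delta_diag => _ dle _ _ /dle dt.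
by rewrite extremal_above// negvar_posvar_diag min_r.
Qed.

(** Both branches equal [delta] on the diagonal, so the lower formula extends to it. *)
Lemma extremal_below x y : 0 <= y -> y <= x -> x <= 1 -> K x y = y - m y x.
Proof.
move=> y0 yx x1; rewrite /K; case: ifPn => // xy.
have -> : x = y by apply/eqP; rewrite eq_le xy yx.
have y01 : 0 <= y <= 1 by lra.
rewrite negvar_posvar_diag min_r; last by case: delta_diag => _ /(_ _ y01).
suff -> : m y y = h y by rewrite /dhat; lra.
apply/eqP; rewrite eq_le dhat_min_le ?lexx//=; last by lra.
by apply: dhat_min_ge => // t yt; have -> : t = y by lra.
Qed.

Lemma negvar_ge0 x : 0 <= x <= 1 -> 0 <= a x.
Proof.
move=> /andP[x0 x1]; have := negvar_increment 0 x (lexx _) x0 x1.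
by rewrite negvar0; lra.
Qed.

Lemma posvar_ge0 x : 0 <= x <= 1 -> 0 <= b x.
Proof.
move=> /andP[x0 x1]; have := posvar_increment 0 x (lexx _) x0 x1.
by rewrite posvar0; lra.
Qed.

Lemma extremal_two_increasing u v c d :
  0 <= u -> u <= v -> v <= 1 -> 0 <= c -> c <= d -> d <= 1 ->
  K v d + K u c - K v c - K u d >= 0.
Proof.
apply: two_increasing_diag_split.
- move=> s t s0 st t1.
  rewrite !extremal_diag; [|lra..].
  rewrite -!negvar_posvar_diag (extremal_below t s)// extremal_above//.
  have := dhat_min_ge_average s t s0 st t1.
  have : Num.min s (a s + b t) <= a s + b t by rewrite ge_min lexx orbT.
  by lra.
(* Above the diagonal K(x, y) = a(x) + min(x - a(x), b(y)), a minimum of nondecreasing functions of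
   separate variables. *)
- move=> {u v c d} u v c d u0 uv vc cd d1.
  have [v1 c0] : v <= 1 /\ 0 <= c by split; lra.
  have := negvar_increment u v u0 uv v1.
  have := posvar_increment c d c0 cd d1.
  rewrite !extremal_above; [|lra..].
  by rewrite !minEle; do 4 case: ifPn; rewrite -?ltNge; lra.
(* Both left-hand minima are at most [m v c], and the smaller one is at most [m u d] because [u, c]
   and [v, d] cover [u, d]. *)
- move=> {u v c d} u v c d u0 uv vc cd d1.
  rewrite !extremal_below; [|lra..].
  suff : m v d + m u c <= m v c + m u d by lra.
  have vdvc : m v d <= m v c.
    by apply: dhat_min_ge => // t /andP[? ?]; apply: dhat_min_le; lra.
  have ucvc : m u c <= m v c.
    by apply: dhat_min_ge => // t /andP[? ?]; apply: dhat_min_le; lra.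
  suff : Num.min (m v d) (m u c) <= m u d.
    by rewrite minEle; case: ifP; lra.
  apply: dhat_min_ge => [|t /andP[ut td]]; first by lra.
  rewrite ge_min; have [tc|/ltW ct] := leP t c.
    by rewrite (dhat_min_le u c)// ?orbT ?ut//; lra.
  by rewrite (dhat_min_le v d)//; lra.
Qed.

Lemma extremal_is_copula : is_copula K.
Proof.
have K01 x y : 0 <= x <= 1 -> 0 <= y <= 1 -> 0 <= K x y <= 1.
  move=> x01 y01; have [xy|/ltW yx] := leP x y.
    rewrite extremal_above// le_min ge_min (andP x01).1 (andP x01).2 /= andbT.
    by rewrite addr_ge0// ?negvar_ge0 ?posvar_ge0.
  have [y0 x1] : 0 <= y /\ x <= 1 by split; lra.
  rewrite extremal_below//.
  have := dhat_min_ge0 y x y0 yx x1; have := dhat_le y y01.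
  have : m y x <= h y by apply: dhat_min_le; lra.
  lra.
split => //.
- move=> x x01; have x0 : 0 <= x by lra.
  have x1 : x <= 1 by lra.
  split.
    rewrite extremal_below//.
    have := dhat_min_ge0 0 x (lexx _) x0 x1.
    have : m 0 x <= h 0 by apply: dhat_min_le; lra.
    by rewrite dhat0; lra.
  by rewrite extremal_above// negvar0 add0r min_l// posvar_ge0.
- move=> x x01; have x0 : 0 <= x by lra.
  have x1 : x <= 1 by lra.
  split; first by rewrite extremal_above// min_l// le_f1.
  rewrite extremal_below//.
  have := dhat_min_ge0 x 1 x0 x1 (lexx _).
  have : m x 1 <= h 1 by apply: dhat_min_le; lra.
  by rewrite dhat1; lra.
- exact: extremal_two_increasing.
Qed.

(** * The largest gap and its maximum *)

Definition max_gap (x y : R) : R := K x y - K y x.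

Lemma max_gapE x y : 0 <= x -> x <= y -> y <= 1 ->
  max_gap x y = Num.min x (a x + b y) - (x - m x y).
Proof. by move=> x0 xy y1; rewrite /max_gap extremal_above// extremal_below. Qed.

Lemma copula_gap_le C x y : is_copula C ->
  (forall t, 0 <= t <= 1 -> C t t = delta t) ->
  0 <= x -> x <= y -> y <= 1 -> C x y - C y x <= max_gap x y.
Proof.
move=> cC Cd x0 xy y1; rewrite max_gapE//.
apply: lerB; last exact: copula_ge_dhat_min.
rewrite le_min copula_le_modular// andbT.
have [x01 y0] : 0 <= x <= 1 /\ 0 <= y by split; lra.
have := copula_increment C x y 1 cC x01 y0 y1 (lexx _).
by case: cC => _ _ /(_ x x01)[-> _] _; lra.
Qed.

Lemma copula_abs_gap_le C x y : is_copula C ->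
  (forall t, 0 <= t <= 1 -> C t t = delta t) ->
  0 <= x -> x <= y -> y <= 1 -> `|C x y - C y x| <= max_gap x y.
Proof.
move=> cC Cd x0 xy y1.
have := copula_gap_le _ x y cC Cd x0 xy y1.
have := copula_gap_le _ x y (copula_transpose _ cC) Cd x0 xy y1.
by rewrite ler_norml /=; lra.
Qed.

Lemma max_gap_attained : exists x y,
  [/\ 0 <= x, x <= y, y <= 1 &
      forall u v, 0 <= u -> u <= v -> v <= 1 -> max_gap u v <= max_gap x y].
Proof.
pose A : set (R * R) := `[0, 1]%classic `*` `[0, 1]%classic.
have Ac : {within A, continuous (fun p => max_gap p.1 p.2)}.
  (* The constant 4 counts two terms, each 1-Lipschitz in each of two variables. *)
  apply: (@lipschitz_within_continuous _ _ _ _ 4) => -[u1 u2] [v1 v2].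
  rewrite /A /= !in_itv /= => -[u10 u20] [v10 v20].
  have cK := extremal_is_copula.
  have cKt := copula_transpose _ cK.
  have := copula_dist _ u1 u2 v2 cK u10 u20 v20.
  have := copula_dist _ v2 u1 v1 cKt v20 u10 v10.
  have := copula_dist _ u2 u1 v1 cK u20 u10 v10.
  have := copula_dist _ v1 u2 v2 cKt v10 u20 v20.
  have : `|u1 - v1| <= `|(u1, u2) - (v1, v2)| by rewrite prod_normE le_max lexx.
  have : `|u2 - v2| <= `|(u1, u2) - (v1, v2)|.
    by rewrite prod_normE le_max lexx orbT.
  rewrite /= /max_gap.
  move: `|u1 - v1| `|u2 - v2| `|(u1, u2) - (v1, v2)| => p q r.
  by rewrite !ler_norml; lra.
have A0 : A !=set0 by exists (0, 0); rewrite /A /= !in_itv /= lexx ler01.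
have Acompact : compact A by apply: compact_setX; exact: segment_compact.
have [[x y]] := compact_EVT_max A0 Acompact Ac.
rewrite inE /A /= !in_itv /= => -[x01 y01] xymax.
have {}xymax u v : 0 <= u -> u <= v -> v <= 1 -> max_gap u v <= max_gap x y.
  move=> u0 uv v1; apply: (xymax (u, v)).
  by rewrite inE /A /= !in_itv /=; lra.
have [xy|/ltW yx] := leP x y.
  by exists x, y; split => //; lra.
(* A maximiser below the diagonal may be reflected: [max_gap] is antisymmetric and nonnegative above
   the diagonal. *)
exists y, x; split => //; [lra|lra|] => u v u0 uv v1.
apply: le_trans (xymax u v u0 uv v1) _.
have : 0 <= max_gap y x.
  apply: le_trans (normr_ge0 _) (copula_abs_gap_le K y x _ _ _ _ _) => //.
  - exact: extremal_is_copula.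
  - exact: extremal_diag.
  - by lra.
  - by lra.
by rewrite /max_gap; lra.
Qed.

(** * The boundary function [gU] *)

Lemma negvar_dist x y : 0 <= x <= 1 -> 0 <= y <= 1 -> `|a x - a y| <= `|x - y|.
Proof.
move=> /andP[x0 x1] /andP[y0 y1]; have [xy|/ltW yx] := leP x y.
  have := negvar_increment x y x0 xy y1.
  by rewrite (distrC x) (@ger0_norm _ (y - x)) ?ler_norml; lra.
by have := negvar_increment y x y0 yx x1; rewrite (@ger0_norm _ (x - y)) ?ler_norml; lra.
Qed.

Lemma posvar_dist x y : 0 <= x <= 1 -> 0 <= y <= 1 -> `|b x - b y| <= `|x - y|.
Proof.
move=> /andP[x0 x1] /andP[y0 y1]; have [xy|/ltW yx] := leP x y.
  have := posvar_increment x y x0 xy y1.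
  by rewrite (distrC x) (@ger0_norm _ (y - x)) ?ler_norml; lra.
by have := posvar_increment y x y0 yx x1; rewrite (@ger0_norm _ (x - y)) ?ler_norml; lra.
Qed.

Local Notation g := (gU delta).

Lemma Df_modular_le x y : 0 <= x -> x < y -> y <= 1 -> Df delta (x, y) ->
  a x + b y <= x.
Proof.
move=> x0 xy y1 [cl|[_ /= yx]]; last by rewrite yx ltxx in xy.
apply/ler_addgt0Pr => e e0.
(* The approximation error enters three times: through [a], through [b] and through x. *)
have e4 : 0 < e / 4 by lra.
have [[u v] [/= [u01 [v01]]]] := cl _ (nbhsx_ballx (x, y) _ e4).
rewrite /= f_deltaE// lt_min => /andP[fu _].
move=> [/=]; rewrite -!ball_normE /= => xu yv.
have x01 : 0 <= x <= 1 by lra.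
have y01 : 0 <= y <= 1 by lra.
have := le_lt_trans (negvar_dist x u x01 u01) xu.
have := le_lt_trans (posvar_dist y v y01 v01) yv.
by move: xu; rewrite !ltr_norml; lra.
Qed.

Lemma gU_has_sup x : 0 <= x <= 1 ->
  has_sup [set y | (0 <= y <= 1) /\ Df delta (x, y)].
Proof.
move=> x01; split; first by exists x; split => //; right.
by exists 1 => y [/andP[]].
Qed.

Lemma gU_bounds x : 0 <= x <= 1 -> x <= g x <= 1.
Proof.
move=> x01; have [S0 S1] := gU_has_sup x x01; apply/andP; split.
  by apply: ub_le_sup => //; split => //; right.
by apply: ge_sup => // y [/andP[]].
Qed.

(** Just beyond [g x], f < x would put a point of [Df_open] above the supremum; continuity of [b]
    brings the bound back to [g x]. If [g x] is 1 there is no room beyond, and [le_f1] applies. *)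
Lemma gU_modular_ge x : 0 <= x <= 1 -> x <= a x + b (g x).
Proof.
move=> x01; have /andP[xg g1] := gU_bounds x x01.
have [->|gN1] := eqVneq (g x) 1; first exact: le_f1.
have {gN1 g1} g1 : g x < 1 by rewrite lt_neqAle gN1.
apply/ler_addgt0Pr => e e0.
pose y := Num.min 1 (g x + e).
have gy : g x < y by rewrite lt_min g1 ltrDl.
have y1 : y <= 1 by rewrite ge_min lexx.
have ye : y <= g x + e by rewrite ge_min lexx orbT.
have y01 : 0 <= y <= 1 by lra.
have g0 : 0 <= g x by lra.
have := posvar_increment (g x) y g0 (ltW gy) y1.
have : x <= a x + b y; last by lra.
rewrite leNgt; apply/negP => fx.
suff : y <= g x by rewrite leNgt gy.
apply: ub_le_sup; first by have [] := gU_has_sup x x01.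
split => //; left; apply: subset_closure; split => //=; split => //=.
by rewrite f_deltaE// lt_min fx; lra.
Qed.

Lemma gU_modular_le x : 0 <= x <= 1 -> x < g x -> a x + b (g x) <= x.
Proof.
move=> x01 xg; have /andP[_ g1] := gU_bounds x x01.
apply/ler_addgt0Pr => e e0.
(* Taking d <= g(x) - x keeps the approximating y strictly above the diagonal, where [Df_modular_le]
   applies. *)
pose d := Num.min e (g x - x).
have d0 : 0 < d by rewrite lt_min e0 subr_gt0.
have [de dg] : d <= e /\ d <= g x - x by rewrite !ge_min !lexx orbT.
have [y [y01 Dy] gy] := sup_adherent d0 (gU_has_sup x x01).
rewrite -/(g x) in gy.
have yg : y <= g x by apply: ub_le_sup => //; have [] := gU_has_sup x x01.
have y0 : 0 <= y by lra.
have := posvar_increment y (g x) y0 yg g1.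
have [x0 xy y1] : [/\ 0 <= x, x < y & y <= 1] by split; lra.
by have := Df_modular_le x y x0 xy y1 Dy; lra.
Qed.

Lemma minFE x : minF delta x = m x (g x).
Proof. by []. Qed.

Lemma minF_max_gap x : 0 <= x <= 1 -> minF delta x = max_gap x (g x).
Proof.
move=> x01; have /andP[xg g1] := gU_bounds x x01.
rewrite max_gapE//; last by lra.
by rewrite min_l ?gU_modular_ge// minFE; lra.
Qed.

(** * Every gap is bounded by a value of [minF] *)

(** With z = b(y), this solves f(u, y) = u. *)
Lemma negvar_defect_IVT x z : 0 <= x <= 1 -> 0 <= z -> z <= x - a x ->
  exists2 u : R, 0 <= u <= x & u - a u = z.
Proof.
move=> x01 z0 zx; have x0 : 0 <= x by lra.
have [||u] := @IVT R (fun u => u - a u) 0 x z x0.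
- apply: (@lipschitz_within_continuous _ _ _ _ 2) => u v /=.
  rewrite !in_itv /= => u0x v0x.
  have u01 : 0 <= u <= 1 by lra.
  have v01 : 0 <= v <= 1 by lra.
  have := negvar_dist u v u01 v01.
  have [uv|uv] := leP 0 (u - v).
    by rewrite (ger0_norm uv) !ler_norml; lra.
  by rewrite (ltr0_norm uv) !ler_norml; lra.
- by rewrite /= negvar0 subr0 min_l ?max_r; lra.
- by rewrite in_itv /=; exists u.
Qed.

(* Moving [x] to the left lowers the target [x - a x] to [b y], at a cost in [h]
   of at most that decrease; past [y], [h] can only grow where [b] is constant. *)
Lemma max_gap_le_minF x y : 0 <= x -> x <= y -> y <= 1 ->
  exists2 u : R, 0 <= u <= 1 & max_gap x y <= minF delta u.
Proof.
move=> x0 xy y1; have x01 : 0 <= x <= 1 by lra.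
have y01 : 0 <= y <= 1 by lra.
have [u [u0 ux uy uh]] : exists u : R, [/\ 0 <= u, u <= x, u - a u <= b y &
    forall t, u <= t <= x -> h x - h t <= x - Num.min x (a x + b y)].
  have [fx|xf] := leP x (a x + b y).
    exists x; split => //; first by lra.
    by move=> t tx; rewrite (_ : t = x) ?subrr; lra.
  have [u ux uE] := negvar_defect_IVT x (b y) x01 (posvar_ge0 y y01) ltac:(lra).
  exists u; split; [lra|lra|by rewrite uE|].
  move=> t /andP[ut tx]; have [u0 t0] : 0 <= u /\ 0 <= t by split; lra.
  have t1 : t <= 1 by lra.
  have := dhat_drop t x t0 tx (andP x01).2.
  by have := negvar_increment u t u0 ut t1; lra.
have u01 : 0 <= u <= 1 by lra.
have /andP[ug g1] := gU_bounds u u01.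
exists u => //; rewrite minFE max_gapE//.
have min_x : Num.min x (a x + b y) <= x by rewrite ge_min lexx.
have mh t : x <= t <= y -> m x y <= h t by exact: dhat_min_le.
apply: dhat_min_ge => // t /andP[ut tg].
have [tx|xt] := leP t x.
  have := uh t; rewrite ut tx => /(_ isT).
  by have := mh x; rewrite lexx xy => /(_ isT); lra.
have [ty|yt] := leP t y.
  by have := mh t; rewrite ty (ltW xt) => /(_ isT); lra.
have ug' : u < g u by lra.
have y0 : 0 <= y by lra.
have t0 : 0 <= t by lra.
have t1 : t <= 1 by lra.
(* Now b(g(u)) <= u - a(u) <= b(y), so the nondecreasing [b] is constant on [y, g(u)]. *)
have fle := gU_modular_le u u01 ug'.
have := posvar_increment y t y0 (ltW yt) t1.
have := posvar_increment t (g u) t0 tg g1.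
move=> bg bt; have bE : b t = b y by lra.
have := posvar_flat y t y0 (ltW yt) t1 bE.
by have := mh y; rewrite lexx xy => /(_ isT); lra.
Qed.

(** * Evaluation of [mu_delta] *)

Lemma gap_has_ubound C : is_copula C ->
  has_ubound [set z | exists x y,
    [/\ 0 <= x <= 1, 0 <= y <= 1 & z = `|C x y - C y x|]].
Proof.
case=> C01 _ _ _; exists 1 => _ [x [y [x01 y01 ->]]].
by have := C01 x y x01 y01; have := C01 y x y01 x01; rewrite ler_norml; lra.
Qed.

Lemma asym_le C z : is_copula C ->
  (forall t, 0 <= t <= 1 -> C t t = delta t) ->
  (forall x y, 0 <= x -> x <= y -> y <= 1 -> max_gap x y <= z) ->
  asym C <= z.
Proof.
move=> cC Cd gz; apply: ge_sup.
  by exists `|C 0 0 - C 0 0|, 0, 0; rewrite lexx ler01.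
move=> _ [x [y [/andP[x0 x1] /andP[y0 y1] ->]]].
have [xy|/ltW yx] := leP x y.
  by apply: le_trans (copula_abs_gap_le C x y cC Cd x0 xy y1) _; exact: gz.
rewrite distrC.
by apply: le_trans (copula_abs_gap_le C y x cC Cd y0 yx x1) _; exact: gz.
Qed.

Lemma mu_deltaE z x y : 0 <= x -> x <= y -> y <= 1 -> max_gap x y = z ->
  (forall u v, 0 <= u -> u <= v -> v <= 1 -> max_gap u v <= z) ->
  mu_delta delta = z.
Proof.
move=> x0 xy y1 xyz gz; have [x01 y01] : 0 <= x <= 1 /\ 0 <= y <= 1 by split; lra.
have muz : ubound [set w | exists C, [/\ is_copula C,
    (forall t, 0 <= t <= 1 -> C t t = delta t) & w = asym C]] z.
  by move=> _ [C [cC Cd ->]]; exact: asym_le.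
have cK := extremal_is_copula.
have Kd := extremal_diag.
apply/eqP; rewrite eq_le; apply/andP; split.
  by apply: ge_sup => //; exists (asym K), K.
apply: (@le_trans _ _ (asym K)).
  rewrite -xyz; apply: le_trans (ler_norm _) _.
  by apply: ub_le_sup; [exact: gap_has_ubound|exists x, y].
by apply: ub_le_sup; [exists z|exists K].
Qed.

End Diagonal.

Theorem theorem4p6 (R : realType) (delta : R -> R) :
  is_diagonal delta ->
  exists x0 : R, [/\ 0 <= x0 <= 1,
    (forall x : R, 0 <= x <= 1 -> minF delta x <= minF delta x0) &
    mu_delta delta = minF delta x0].
Proof.
move=> dd; have [x [y [x0 xy y1 xymax]]] := max_gap_attained delta dd.
have [u u01 xyu] := max_gap_le_minF delta dd x y x0 xy y1.
(* Each value of [minF] is itself a gap, so [u] attains the maximum of [minF], which equals the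
   maximal gap. *)
have minF_le (v : R) : 0 <= v <= 1 -> minF delta v <= max_gap delta x y.
  move=> v01; have /andP[vg g1] := gU_bounds delta v v01.
  by rewrite minF_max_gap//; apply: xymax => //; case/andP: v01.
have minFu : minF delta u = max_gap delta x y.
  by apply/eqP; rewrite eq_le minF_le.
exists u; split => //; first by move=> v v01; rewrite minFu minF_le.
by rewrite minFu; apply: (mu_deltaE delta dd _ x y).
Qed.
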